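(* Let $m\ge1$, $0=c_1<c_2<\cdots<c_m$ be fixed, $\vec c=(c_1,\dots,c_m)$, and for $x\in\mathbb{R}$ put $t_k=c_k+x$ ($k=1,\dots,m$). Let $\omega_0,\dots,\omega_m$ be real with $\sum_{k=0}^\ell\omega_k\ge0$ for $\ell=0,\dots,m$, such that $w(s)={\rm e}^{-s^2}\big(\omega_0+\sum_{k=1}^m\omega_k\theta(s-t_k)\big)$ is not identically zero. Let $D_n(x;\vec c)=\det\big(\int_{\mathbb{R}}s^{i+j}w(s)ds\big)_{i,j=0}^{n-1}$ ($D_0:=1$), $\hat D_n(x;\vec c):={\rm e}^{nx^2}D_n(x;\vec c)$, and let $R_{n,k}(x;\vec c)$ be as in the context. Then for $n\ge1$: (i) $$\frac{d^2}{dx^2}\ln\hat D_n=4\frac{\hat D_{n+1}\hat D_{n-1}}{\hat D_n^2};$$ (ii) for each $k=1,\dots,m$, wherever $R_{n,k}\ne0$, $$\frac{d^2R_{n,k}}{dx^2}-\frac{1}{2R_{n,k}}\Big(\frac{dR_{n,k}}{dx}\Big)^2=R_{n,k}\Bigg[\frac32\Big(\sum_{j=1}^mR_{n,j}\Big)^2-2\sum_{j=1}^m(c_k+c_j+2x)R_{n,j}+2\big((c_k+x)^2-2n-1\big)\Bigg];$$ (iii) if $R_{n,k}(y;\vec c)\ne0$ for all $k$ and all $y$ between $0$ and $x$, then $$\frac{\hat D_n(x;\vec c)}{\hat D_n(0;\vec c)}={\rm e}^{nx^2}\exp\Bigg[\frac14\int_0^x\Bigg(-\sum_{k=1}^m\frac{(R_{n,k}')^2}{2R_{n,k}}+\frac12\Big(\sum_{k=1}^mR_{n,k}\Big)^3+\sum_{k=1}^m2(c_k+y)^2R_{n,k}-\Big(\sum_{k=1}^m2(c_k+y)R_{n,k}+4n\Big)\sum_{j=1}^mR_{n,j}\Bigg)dy\Bigg],$$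 where in the integrand $R_{n,k}=R_{n,k}(y;\vec c)$ and $'=d/dy$.
   Context: $\theta(y)=1$ for $y>0$ and $0$ otherwise. $P_n(z)$ is the monic degree-$n$ polynomial orthogonal w.r.t. $w$ on $\mathbb{R}$ (which depends on $x$ through the $t_k$), $\int P_jP_kw\,ds=h_k\delta_{jk}$, $h_k>0$. $R_{n,k}(x;\vec c):=\omega_k{\rm e}^{-t_k^2}P_n(t_k)^2/h_n$ with $t_k=c_k+x$. *)

(* Defs.v *)
From HB Require Import structures.
From mathcomp Require Import all_boot all_order all_algebra.
From mathcomp Require Import all_classical all_reals all_analysis.
Set Implicit Arguments. Unset Strict Implicit. Unset Printing Implicit Defensive.
Import Order.TTheory GRing.Theory Num.Theory.
Local Open Scope classical_set_scope.
Local Open Scope ring_scope.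

Section Defs.
Variable R : realType.

Definition theta (y : R) : R := if 0 < y then 1 else 0.

(* c, omega are sequences indexed by nat; only c 1..c m and omega 0..omega m matter.
   t_k = c_k + x *)
Definition weight (m : nat) (c omega : nat -> R) (x s : R) : R :=
  expR (- s ^+ 2) *
  (omega 0%N + \sum_(1 <= k < m.+1) omega k * theta (s - (c k + x))).

Definition Rint (f : R -> R) : R := Rintegral lebesgue_measure setT f.

Definition moment m c omega (x : R) (j : nat) : R :=
  Rint (fun s => s ^+ j * weight m c omega x s).

(* Hankel determinant D_n = det (mu_{i+j})_{i,j=0}^{n-1}; D_0 = 1 (empty det) *)
Definition hankelD m c omega (n : nat) (x : R) : R :=
  \det (\matrix_(i < n, j < n) moment m c omega x (i + j)%N).

Definition hankelDhat m c omega (n : nat) (x : R) : R :=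
  expR (n%:R * x ^+ 2) * hankelD m c omega n x.

Definition is_monic_OP m c omega (x : R) (n : nat) (p : {poly R}) : Prop :=
  p \is monic /\ size p = n.+1 /\
  (forall j : nat, (j < n)%N -> Rint (fun s => p.[s] * s ^+ j * weight m c omega x s) = 0).

Definition OP m c omega (n : nat) (x : R) : {poly R} :=
  xget 0 (is_monic_OP m c omega x n).

Definition hnorm m c omega (n : nat) (x : R) : R :=
  Rint (fun s => (OP m c omega n x).[s] ^+ 2 * weight m c omega x s).

Definition Rnk m c omega (n k : nat) (x : R) : R :=
  omega k * expR (- (c k + x) ^+ 2) * (OP m c omega n x).[c k + x] ^+ 2
  / hnorm m c omega n x.

Definition oint (a b : R) (f : R -> R) : R :=
  if a <= b then Rintegral lebesgue_measure `[a, b] f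
  else - Rintegral lebesgue_measure `[b, a] f.

End Defs.

(* Main.v *)
Require Import Defs.
From HB Require Import structures.
From mathcomp Require Import all_boot all_order all_algebra.
From mathcomp Require Import all_classical all_reals all_analysis.
From mathcomp Require Import measurable_realfun ring lra zify.
Set Implicit Arguments. Unset Strict Implicit. Unset Printing Implicit Defensive.
Import Order.TTheory GRing.Theory Num.Theory.
Import numFieldNormedType.Exports.
Local Open Scope classical_set_scope.
Local Open Scope ring_scope.

(** Write L_x(q) for the integral of q w, and put P_{-1} = 0,
    b_n = h_n / h_{n-1}, X P_n = P_{n+1} + a_n P_n + b_n P_{n-1}.  Since x moves
    only the jumps t_k of the weight, the fundamental theorem of calculus and an
    integration by parts both evaluate to the jump terms, and
      d/dx L_x(q) = L_x(q' - 2 X q) = - sum_k omega_k e^{-t_k^2} q(t_k)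
    for a fixed polynomial q.  Hence in the frame moving with x the derivation
    nabla = d/dx + d/ds satisfies nabla P_n = 2 b_n P_{n-1} and
    h_n' = - 2 a_n h_n: this is the Toda flow, and (i) follows from
    D_n = h_0 ... h_{n-1}.  With
      r_k = omega_k e^{-t_k^2} P_n(t_k) P_{n-1}(t_k) / h_{n-1}
    one gets
      R_k' = R_k (2 a_n - 2 t_k) + 4 r_k,   r_k' = 2 b_n (R_{n-1,k} - R_{n,k}),
      r_k^2 = b_n R_{n,k} R_{n-1,k},
    while the integrations by parts for q = P_n^2, P_n P_{n-1} and
    X P_n P_{n-1} give
      2 a_n = sum_k R_k,   2 b_n = n + sum_k r_k,
      a_0 + ... + a_{n-1} = 2 b_n (a_n + a_{n-1}) - sum_k t_k r_k.
    Eliminating r_k, a_n and b_n yields (ii), and shows that the integrand of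
    (iii) is - 8 (a_0 + ... + a_{n-1}), that is 4 d/dy (ln Dhat_n - n y^2). *)

(** * Gaussian integrals of polynomials *)

Section RealDerivatives.
Variable R : realType.
Implicit Types (f g : R -> R) (a b x r : R).

Lemma is_derive_add f g x a b : is_derive x 1 f a -> is_derive x 1 g b ->
  is_derive x 1 (fun y => f y + g y) (a + b).
Proof. exact: is_deriveD. Qed.

Lemma is_derive_sub f g x a b : is_derive x 1 f a -> is_derive x 1 g b ->
  is_derive x 1 (fun y => f y - g y) (a - b).
Proof. exact: is_deriveB. Qed.

Lemma is_derive_mul f g x a b : is_derive x 1 f a -> is_derive x 1 g b ->
  is_derive x 1 (fun y => f y * g y) (a * g x + f x * b).
Proof.
move=> hf hg; apply: (is_derive_eq (is_deriveM hf hg)).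
by rewrite addrC /GRing.scale /= [g x * a]mulrC.
Qed.

Lemma is_derive_mulr r f x a : is_derive x 1 f a ->
  is_derive x 1 (fun y => r * f y) (r * a).
Proof. exact: is_deriveZ. Qed.

Lemma is_derive_div f g x a b : g x != 0 ->
  is_derive x 1 f a -> is_derive x 1 g b ->
  is_derive x 1 (fun y => f y / g y) ((a * g x - f x * b) / g x ^+ 2).
Proof.
move=> gx hf hg; apply: (is_derive_eq (is_derive_mul hf (is_deriveV gx hg))).
by rewrite /GRing.scale /=; field.
Qed.

Lemma is_derive_bigsum (I : Type) (s : seq I) (P : pred I) (h : I -> R -> R)
    (dh : I -> R) x :
  (forall i, P i -> is_derive x 1 (h i) (dh i)) ->
  is_derive x 1 (fun y => \sum_(i <- s | P i) h i y) (\sum_(i <- s | P i) dh i).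
Proof.
move=> hd; elim: s => [|i s IH].
  rewrite big_nil; under eq_fun do rewrite big_nil; exact: is_derive_cst.
rewrite big_cons; under eq_fun do rewrite big_cons.
by case: ifP => // Pi; apply: is_derive_add => //; exact: hd.
Qed.

Lemma is_derive_unique f x a b :
  is_derive x 1 f a -> is_derive x 1 f b -> a = b.
Proof. by move=> ha hb; rewrite -(@derive_val _ _ _ _ _ _ _ ha) derive_val. Qed.

Lemma is_derive_derive1 f x a : is_derive x 1 f a -> derive1 f x = a.
Proof. by move=> h; rewrite derive1E derive_val. Qed.

Lemma derivable_is_derive1 f x : derivable f x 1 -> is_derive x 1 f (derive1 f x).
Proof. by move=> h; rewrite derive1E; exact: derivableP. Qed.

Lemma is_derive_continuous f x a : is_derive x 1 f a -> {for x, continuous f}.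
Proof.
by case=> h _; apply/differentiable_continuous; exact/derivable1_diffP.
Qed.

Lemma is_derive_horner_shift (q : {poly R}) (r x : R) :
  is_derive x 1 (fun y => q.[r + y]) q^`().[r + x].
Proof.
have h : is_derive x 1 (fun y => r + y) (0 + 1).
  exact: is_derive_add.
apply: (is_derive_eq (@is_derive1_comp _ _ _ _ _ _ (is_derive_poly q (r + x)) h)).
by rewrite add0r mulr1.
Qed.

Lemma is_derive_gauss_shift r x :
  is_derive x 1 (fun y => expR (- (r + y) ^+ 2))
    (- 2 * (r + x) * expR (- (r + x) ^+ 2)).
Proof.
have e y : - (r + y) ^+ 2 = (- 'X ^+ 2 : {poly R}).[r + y] by rewrite !hornerE.
have h : is_derive x 1 (fun y => - (r + y) ^+ 2) (- 'X ^+ 2 : {poly R})^`().[r + x].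
  by under eq_fun do rewrite e; exact: is_derive_horner_shift.
apply: (is_derive_eq (@is_derive1_comp _ _ _ _ _ _ (is_derive_expR _) h)).
by rewrite derivN derivXn !hornerE /= ; ring.
Qed.

End RealDerivatives.

Section GaussianIntegrals.
Variable R : realType.
Notation mu := (@lebesgue_measure R).
Implicit Types (q : {poly R}) (s t : R).

Definition gauss_poly q s : R := q.[s] * expR (- s ^+ 2).

(** The Taylor bound 1 + u^(j+1) / (j+1)! <= e^u at u = s^2 / 2 dominates s^(2(j+1)), hence |s^j|
    once |s| > 1. Only half of the Gaussian exponent is spent, so that the other half remains
    available for integrability and decay. *)
Lemma expn_half_gauss_bounded (j : nat) :
  exists C : R, forall s, `|s ^+ j| * expR (- s ^+ 2 / 2) <= C.
Proof.
(* The 1 covers |s| <= 1; the second summand is the inverse of the Taylor coefficient of (s^2)^(j+1)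
   in e^(s^2 / 2). *)
exists (1 + 2 ^+ j.+1 * (j.+1)`!%:R) => s.
set e := expR _; have e0 : 0 < e by exact: expR_gt0.
have e1 : e <= 1 by rewrite -expR0 ler_expR; have := sqr_ge0 s; lra.
have le1 : `|s ^+ j| <= 1 + s ^+ 2 ^+ j.+1.
  rewrite normrX -(real_normK (num_real s)); have := normr_ge0 s.
  case: (lerP `|s| 1) => [s1 s0|s1 s0].
    have := exprn_ile1 j s0 s1; have := exprn_ge0 j.+1 (exprn_ge0 2 s0); lra.
  have : `|s| ^+ j <= `|s| ^+ 2 ^+ j.+1.
    by rewrite -exprM ler_weXn2l ?ltW//; lia.
  lra.
have s2 : 0 <= s ^+ 2 / 2 by rewrite divr_ge0 ?sqr_ge0.
have le2 := expR_ge1Dxn j s2.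
have ee : expR (s ^+ 2 / 2) * e = 1 by rewrite -expRD -expR0; congr expR; lra.
have f0 : 0 < (j.+1)`!%:R :> R by rewrite ltr0n fact_gt0.
have le3 : s ^+ 2 ^+ j.+1 <= 2 ^+ j.+1 * (j.+1)`!%:R * expR (s ^+ 2 / 2).
  rewrite [X in _ <= X * _]mulrC -mulrA -ler_pdivrMl// mulrC -ler_pdivrMl ?exprn_gt0//.
  have -> : (2 ^+ j.+1)^-1 * (s ^+ 2 ^+ j.+1 / (j.+1)`!%:R) =
      (s ^+ 2 / 2) ^+ j.+1 / (j.+1)`!%:R by rewrite expr_div_n; ring.
  lra.
apply: (le_trans (ler_wpM2r (ltW e0) le1)).
rewrite mulrDl mul1r lerD//.
by apply: (le_trans (ler_wpM2r (ltW e0) le3)); rewrite -[leLHS]mulrA ee mulr1.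
Qed.

Lemma poly_half_gauss_bounded q :
  exists C : R, forall s, `|q.[s]| * expR (- s ^+ 2 / 2) <= C.
Proof.
have /choice[C hC] := expn_half_gauss_bounded.
exists (\sum_(i < size q) `|q`_i| * C i) => s.
rewrite horner_coef (le_trans (ler_wpM2r (expR_ge0 _) (ler_norm_sum _ _ _)))//.
rewrite mulr_suml ler_sum// => i _.
by rewrite normrM -mulrA ler_wpM2l.
Qed.

Lemma gauss_poly_continuous q : continuous (gauss_poly q).
Proof.
move=> s; apply: cvgM; first exact: continuous_horner.
exact: continuous_gauss_fun.
Qed.

(** One factor e^(-s^2 / 2) bounds the polynomial, and the other is a multiple of the standard
    normal density, which is integrable. *)
Lemma integrable_gauss_poly q (A : set R) : measurable A ->
  mu.-integrable A (EFin \o gauss_poly q).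
Proof.
move=> mA; apply: (@integrableS _ _ _ _ setT) => //.
have [C hC] := poly_half_gauss_bounded q.
have n1 : (1 : R) != 0 by exact: oner_neq0.
have := @integrable_normal_pdf R 0 1.
move=> /(integrableZl measurableT (C / normal_peak 1)).
apply: le_integrable => //.
  apply/measurable_EFinP; apply: continuous_measurable_fun.
  exact: gauss_poly_continuous.
move=> s _ /=; rewrite lee_fin /normal_pdf (negbTE n1) /normal_fun.
have -> : (- (s - 0) ^+ 2 / (1 ^+ 2 *+ 2)) = - s ^+ 2 / 2 by lra.
have p0 : normal_peak (1 : R) != 0 by rewrite gt_eqF// normal_peak_gt0.
rewrite mulrA divfK// /gauss_poly.
have -> : expR (- s ^+ 2) = expR (- s ^+ 2 / 2) * expR (- s ^+ 2 / 2).
  by rewrite -expRD; congr expR; lra.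
rewrite mulrA !normrM [X in _ <= _ * X]ger0_norm ?expR_ge0//.
rewrite [X in _ * _ * X <= _]ger0_norm ?expR_ge0// ler_wpM2r ?expR_ge0//.
rewrite [X in _ * X <= _]ger0_norm ?expR_ge0//.
by rewrite (le_trans (hC s))// ler_norm.
Qed.

(** Dominated convergence for the restrictions of f to the sets [A_ n], with |f| as the dominating
    function. *)
Lemma Rintegral_cvg_sets (f : R -> R) (A_ : nat -> set R) (A : set R) :
  mu.-integrable setT (EFin \o f) ->
  (forall n, measurable (A_ n)) -> measurable A ->
  (forall s, \forall n \near \oo, A_ n s <-> A s) ->
  (\int[mu]_(s in A_ n) f s)%R @[n --> \oo] --> (\int[mu]_(s in A) f s)%R.
Proof.
move=> fi mA_ mA hA; apply: fine_cvg; rewrite /= fineK; last first.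
  by apply: integrable_fin_num => //; exact: integrableS fi.
have mf : measurable_fun setT (EFin \o f) by exact: measurable_int fi.
have [] := @dominated_convergence _ _ R mu setT measurableT
  (fun n => (EFin \o f) \_ (A_ n)) ((EFin \o f) \_ A) (abse \o (EFin \o f)).
- by move=> n; apply/(measurable_restrictT _ (mA_ n)); exact: measurable_funS mf.
- by apply/(measurable_restrictT _ mA); exact: measurable_funS mf.
- apply: aeW => s _; apply: cvg_near_cst; apply: filterS (hA s) => n e.
  rewrite /patch; have -> // : (s \in A_ n) = (s \in A).
  by apply/idP/idP; rewrite !inE => ?; apply/e.
- exact: integrable_abse.
- apply: aeW => s n _; rewrite /patch; case: ifP => // _.
  by rewrite abse0 abse_ge0.
- move=> _ _; rewrite integral_mkcond.
- rewrite patch_setT => h; rewrite [X in _ --> X]integral_mkcond.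
  by under eq_fun do rewrite integral_mkcond.
Qed.


Lemma is_derive_gauss_primitive q t :
  is_derive t 1 (fun t => \int[mu]_(s in `]-oo, t]) gauss_poly q s) (gauss_poly q t).
Proof.
(* Any right endpoint beyond t would do; t + 1 is one. *)
have t1 : t < t + 1 by rewrite ltrDl.
have [] := @continuous_FTC1 R (gauss_poly q) -oo%O t (t + 1) t1 _ _
  (@gauss_poly_continuous q t).
- exact: integrable_gauss_poly.
- by rewrite ltNyr.
- by move=> h <-; exact: derivable_is_derive1.
Qed.

(** The polynomial factor of the derivative of q e^(-s^2). *)
Definition gauss_deriv q : {poly R} := q^`() - 2 *: ('X * q).

Lemma is_derive_gauss_poly q t :
  is_derive t 1 (gauss_poly q) (gauss_poly (gauss_deriv q) t).
Proof.
have h := is_derive_gauss_shift 0 t.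
have e : (fun y : R => expR (- (0 + y) ^+ 2)) = (fun y => expR (- y ^+ 2)).
  by apply/funext => y; rewrite add0r.
rewrite e add0r in h.
apply: (is_derive_eq (is_derive_mul (is_derive_poly q t) h)).
by rewrite /gauss_poly /gauss_deriv !hornerE /=; ring.
Qed.

(** Boundedness of s q(s) e^(-s^2 / 2) gives decay of order 1 / |s|. The hypothesis on |u n| serves
    both ends of the line at once. *)
Lemma gauss_poly_cvg0 q (u : nat -> R) : (forall n, `|u n| = n.+1%:R) ->
  gauss_poly q (u n) @[n --> \oo] --> 0.
Proof.
move=> hu; have [C hC] := poly_half_gauss_bounded ('X * q).
apply/norm_cvg0P/(@squeeze_cvgr _ _ _ _ (cst 0) (fun n => C * harmonic n)).
- near=> n; rewrite normr_ge0 /= /gauss_poly normrM [X in _ * X]ger0_norm ?expR_ge0//.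
  have := hC (u n); rewrite hornerM hornerX normrM hu => h.
  rewrite /harmonic ler_pdivlMr ?ltr0n// mulrC mulrA.
  apply: le_trans h; rewrite ler_wpM2l// ?mulr_ge0// ler_expR.
  by have := sqr_ge0 (u n); lra.
- exact: cvg_cst.
- by rewrite -[X in _ --> X](mulr0 C); apply: cvgMr; exact: cvg_harmonic.
Unshelve. all: by end_near. Qed.

(** Both sides have the same derivative in t, so their difference is constant; along t = -(n+1) the
    half-lines shrink to the empty set and the difference tends to 0. *)
Lemma gauss_integral_by_parts_Ny q t :
  \int[mu]_(s in `]-oo, t]) gauss_poly (gauss_deriv q) s = gauss_poly q t.
Proof.
pose K t := \int[mu]_(s in `]-oo, t]) gauss_poly (gauss_deriv q) s.
have dK (x : R) : is_derive x 1 (fun t => K t - gauss_poly q t) 0.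
  apply: (is_derive_eq (is_derive_sub (is_derive_gauss_primitive _ x)
    (is_derive_gauss_poly q x))); exact: subrr.
apply/eqP; rewrite -subr_eq0; apply/eqP; rewrite -/(K t).
have l : (K (- n.+1%:R) - gauss_poly q (- n.+1%:R)) @[n --> \oo] --> (0 - 0 : R).
  apply: cvgB; last by apply: gauss_poly_cvg0 => n; rewrite normrN ger0_norm.
  rewrite -[X in _ --> X](Rintegral_set0 mu (gauss_poly (gauss_deriv q))).
  apply: Rintegral_cvg_sets => //; first exact: integrable_gauss_poly.
  move=> s; near=> n; split => //=; rewrite in_itv/= => sn.
  have : - s < n%:R by near: n; exact: nbhs_infty_gtr.
  have : n%:R < n.+1%:R :> R by rewrite ltr_nat.
  by lra.
rewrite subr0 in l; apply: cvg_unique l => //.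
by apply: cvg_near_cst; apply: nearW => n; exact: (is_derive_0_is_cst _ _ dK).
Unshelve. all: by end_near. Qed.

Lemma gauss_integral_by_parts q :
  \int[mu]_s gauss_poly (gauss_deriv q) s = 0.
Proof.
have l : \int[mu]_(s in `]-oo, n.+1%:R]) gauss_poly (gauss_deriv q) s
    @[n --> \oo] --> (0 : R).
  under eq_fun do rewrite gauss_integral_by_parts_Ny.
  by apply: gauss_poly_cvg0 => n; rewrite ger0_norm.
apply: cvg_unique l => //; apply: Rintegral_cvg_sets => //; first exact: integrable_gauss_poly.
move=> s; near=> n; split => //= _; rewrite in_itv/= ltW//.
apply: (@lt_trans _ _ n%:R); last by rewrite ltr_nat.
near: n; exact: nbhs_infty_gtr.
Unshelve. all: by end_near. Qed.

End GaussianIntegrals.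

(** * The weight as a linear functional *)

Section WeightFunctional.
Variables (R : realType) (m : nat) (c omega : nat -> R).
Notation mu := (@lebesgue_measure R).
Implicit Types (q : {poly R}) (s t x : R).

Lemma integrable_bigsum (I : Type) (r : seq I) (f : I -> R -> R) :
  (forall i, mu.-integrable setT (EFin \o f i)) ->
  mu.-integrable setT (EFin \o (fun s => \sum_(i <- r) f i s)).
Proof.
move=> hf; have := @integrable_sum _ _ R mu setT measurableT I r xpredT
  (fun i => EFin \o f i) (fun i _ => hf i).
by apply: eq_integrable => // s _; rewrite /= -sumEFin.
Qed.

Lemma Rintegral_bigsum (I : Type) (r : seq I) (f : I -> R -> R) :
  (forall i, mu.-integrable setT (EFin \o f i)) ->
  \int[mu]_s (\sum_(i <- r) f i s) = \sum_(i <- r) \int[mu]_s f i s.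
Proof.
move=> hf; elim: r => [|i r IH].
  rewrite big_nil; under eq_Rintegral do rewrite big_nil.
  by rewrite Rintegral_cst// mul0r.
rewrite big_cons -IH; under eq_Rintegral do rewrite big_cons.
by rewrite RintegralD//; exact: integrable_bigsum.
Qed.

(** This is the functional L_x. *)
Definition wfun x q : R := Defs.Rint (fun s => q.[s] * weight m c omega x s).

Let tail t q s := (gauss_poly q \_ `]t, +oo[) s.

(** The half-line is open at t because [theta] vanishes at 0. *)
Lemma theta_gauss_poly t q s : theta (s - t) * gauss_poly q s = tail t q s.
Proof.
rewrite /tail /theta patchE subr_gt0; have [ts|ts] := ltP.
  by rewrite mem_set ?mul1r//= in_itv/= ts.
by rewrite memNset ?mul0r// /= in_itv/= ltNge ts.
Qed.

Let integrable_tail t q : mu.-integrable setT (EFin \o tail t q).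
Proof.
rewrite -[_ \o _]/(fun s => ((gauss_poly q \_ `]t, +oo[) s)%:E).
have := @integrable_mkcond _ _ R mu `]t, +oo[%classic (EFin \o gauss_poly q).
move=> /(_ (measurable_itv _)) [] + _ => /(_ (integrable_gauss_poly _ _)) h.
have : mu.-integrable setT ((EFin \o gauss_poly q) \_ `]t, +oo[).
  by apply: h; exact: measurable_itv.
by rewrite restrict_EFin.
Qed.

Let Rintegral_tail t q : \int[mu]_s tail t q s =
  \int[mu]_s gauss_poly q s - \int[mu]_(s in `]-oo, t]) gauss_poly q s.
Proof.
rewrite -Rintegral_mkcond -set_itvNyy Rintegral_itvB//.
exact: integrable_gauss_poly.
Qed.

Let poly_weightE x q s : q.[s] * weight m c omega x s =
  omega 0%N * gauss_poly q s +
  \sum_(1 <= k < m.+1) omega k * tail (c k + x) q s.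
Proof.
rewrite /weight mulrA -/(gauss_poly q s) mulrDr mulrC mulr_sumr; congr (_ + _).
by apply: eq_bigr => k _; rewrite -theta_gauss_poly; ring.
Qed.

Lemma integrable_poly_weight x q :
  mu.-integrable setT (EFin \o (fun s => q.[s] * weight m c omega x s)).
Proof.
under eq_fun do rewrite poly_weightE.
have i0 : mu.-integrable setT (EFin \o (fun s => omega 0%N * gauss_poly q s)).
  have := integrable_gauss_poly q measurableT.
  move=> /(integrableZl measurableT (omega 0%N)).
  by apply: eq_integrable.
have i1 : mu.-integrable setT
    (EFin \o (fun s => \sum_(1 <= k < m.+1) omega k * tail (c k + x) q s)).
  apply: integrable_bigsum => k.
  have /(integrableZl measurableT (omega k)) := integrable_tail (c k + x) q.
  by apply: eq_integrable.
by have := integrableD measurableT i0 i1; apply: eq_integrable.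
Qed.

(** Each tail integral is written as the full integral minus a primitive, so that x enters only
    through the upper endpoints c_k + x. *)
Lemma wfunE x q : wfun x q = omega 0%N * \int[mu]_s gauss_poly q s +
  \sum_(1 <= k < m.+1) omega k * (\int[mu]_s gauss_poly q s -
    \int[mu]_(s in `]-oo, c k + x]) gauss_poly q s).
Proof.
have -> : wfun x q = \int[mu]_s (omega 0%N * gauss_poly q s +
    \sum_(1 <= k < m.+1) omega k * tail (c k + x) q s).
  by apply: eq_Rintegral => s _; exact: poly_weightE.
have iZ k t : mu.-integrable setT (EFin \o (fun s => omega k * tail t q s)).
  have /(integrableZl measurableT (omega k)) := integrable_tail t q.
  by apply: eq_integrable.
rewrite RintegralD//; last 2 first.
- have := integrable_gauss_poly q measurableT.
  move=> /(integrableZl measurableT (omega 0%N)).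
  by apply: eq_integrable.
- exact: integrable_bigsum.
rewrite Rintegral_bigsum// RintegralZl//; last exact: integrable_gauss_poly.
congr (_ + _); apply: eq_bigr => k _.
by rewrite RintegralZl// Rintegral_tail.
Qed.

Fact wfun_is_linear x : linear_for *%R (wfun x).
Proof.
move=> a p q.
have -> : wfun x (a *: p + q) = \int[mu]_s (a * (p.[s] * weight m c omega x s) +
    q.[s] * weight m c omega x s).
  by apply: eq_Rintegral => s _; rewrite hornerD hornerZ mulrDl -mulrA.
rewrite RintegralD// ?RintegralZl//; try exact: integrable_poly_weight.
have := integrable_poly_weight x p.
move=> /(integrableZl measurableT a).
by apply: eq_integrable.
Qed.

HB.instance Definition _ x :=
  GRing.isLinear.Build R {poly R} R *%R (wfun x) (wfun_is_linear x).

Lemma wfun_by_parts x q : wfun x (gauss_deriv q) =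
  - \sum_(1 <= k < m.+1) omega k * gauss_poly q (c k + x).
Proof.
rewrite wfunE gauss_integral_by_parts mulr0 add0r -sumrN.
apply: eq_bigr => k _.
by rewrite gauss_integral_by_parts_Ny sub0r mulrN.
Qed.

(** Moving the endpoints c_k + x produces exactly the boundary terms that [wfun_by_parts] finds. *)
Lemma is_derive_wfun x q :
  is_derive x 1 (fun y => wfun y q) (wfun x (gauss_deriv q)).
Proof.
rewrite wfun_by_parts -sumrN; under eq_fun do rewrite wfunE.
have d k : is_derive x 1 (fun y => omega k * (\int[mu]_s gauss_poly q s -
    \int[mu]_(s in `]-oo, c k + y]) gauss_poly q s))
    (omega k * (0 - gauss_poly q (c k + x) * (0 + 1))).
  apply/is_derive_mulr/is_derive_sub.
  have h : is_derive x 1 (fun y => c k + y) (0 + 1) by exact: is_derive_add.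
  exact: (is_derive1_comp (is_derive_gauss_primitive q (c k + x)) h).
apply: (is_derive_eq (is_derive_add (is_derive_cst _ x 1)
  (is_derive_bigsum _ (fun k _ => d k)))).
by rewrite add0r; apply: eq_bigr => k _; ring.
Qed.

Lemma momentE x j : moment m c omega x j = wfun x 'X^j.
Proof. by rewrite /moment /wfun; under eq_fun do rewrite -hornerXn. Qed.

End WeightFunctional.

(** * Positive definiteness of the weight functional *)

Section Positivity.
Variables (R : realType) (m : nat) (c omega : nat -> R) (x : R).
Notation mu := (@lebesgue_measure R).
Hypothesis c_incr : forall k : nat, (1 <= k)%N -> (k < m)%N -> c k < c k.+1.
Hypothesis partial_sum_ge0 :
  forall l : nat, (l <= m)%N -> 0 <= \sum_(0 <= k < l.+1) omega k.
Hypothesis weight_neq0 : ~ (forall s : R, weight m c omega x s = 0).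

Definition weight_step s : R :=
  omega 0%N + \sum_(1 <= k < m.+1) omega k * theta (s - (c k + x)).

(** Induction on the number of jumps kept. Beyond the last one every [theta] equals 1, since c is
    increasing, and a partial sum of the omega_k appears; otherwise the last term vanishes and drops
    out. *)
Lemma weight_step_ge0 s : 0 <= weight_step s.
Proof.
rewrite /weight_step; elim: {-2}m (leqnn m) => [|l IH] lm.
  by rewrite big_geq// addr0; have := partial_sum_ge0 (leq0n m); rewrite big_nat1.
have [le_s|lt_s] := leP s (c l.+1 + x); last first.
  have -> : omega 0%N + \sum_(1 <= k < l.+2) omega k * theta (s - (c k + x)) =
      \sum_(0 <= k < l.+2) omega k; last exact: partial_sum_ge0.
  rewrite [RHS]big_ltn//; congr (_ + _); apply: eq_big_nat => k /andP[k1 kl].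
  suff ck : c k <= c l.+1.
    by rewrite /theta subr_gt0 (le_lt_trans _ lt_s) ?lerD2r// mulr1.
  elim: l lm k kl k1 {IH lt_s} => [|l IHl] lm k kl k1.
    by have -> : k = 1%N by lia.
  have [->//|kl'] := eqVneq k l.+2.
  apply: (@le_trans _ _ (c l.+1)); last by rewrite ltW// c_incr.
  by apply: IHl; lia.
rewrite big_nat_recr//= {2}/theta subr_gt0 ltNge le_s /= mulr0 addr0.
by apply: IH; lia.
Qed.

Lemma weight_ge0 s : 0 <= weight m c omega x s.
Proof. by rewrite /weight mulr_ge0 ?expR_ge0//; exact: weight_step_ge0. Qed.

(** [theta] is left continuous and there are finitely many jumps, so e can be taken below the
    distance from s to every jump strictly to its left. *)
Lemma weight_step_left_constant s :
  exists2 e : R, 0 < e & forall s', s - e < s' <= s -> weight_step s' = weight_step s.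
Proof.
rewrite /weight_step; elim: m => [|l [e e0 he]].
  by exists 1 => // s' _; rewrite !big_geq.
have [le_s|lt_s] := leP s (c l.+1 + x).
  exists e => // s' h; rewrite !(big_nat_recr l.+1)//= !addrA he//; congr (_ + _).
  move: h => /andP[_ s's].
  by rewrite /theta !subr_gt0 !ltNge le_s (le_trans s's le_s).
exists (Num.min e (s - (c l.+1 + x))); first by rewrite lt_min e0 subr_gt0.
move=> s' /andP[h s's].
rewrite !(big_nat_recr l.+1)//= !addrA he; last first.
  rewrite s's andbT (le_lt_trans _ h)// lerD2l lerN2 ge_min lexx//.
congr (_ + _); rewrite /theta !subr_gt0 lt_s.
suff -> : c l.+1 + x < s' by [].
apply: le_lt_trans h; have : Num.min e (s - (c l.+1 + x)) <= s - (c l.+1 + x).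
  by rewrite ge_min lexx orbT.
lra.
Qed.

Lemma weight_gt0_interval :
  exists a b : R, a < b /\ forall s, a < s <= b -> 0 < weight m c omega x s.
Proof.
have [s0 ws0] : exists s0, weight m c omega x s0 != 0.
  apply: contrapT => h; apply: weight_neq0 => s; apply/eqP; apply: contrapT.
  by move=> /negP ns; apply: h; exists s.
have st0 : 0 < weight_step s0.
  rewrite lt_neqAle weight_step_ge0 andbT eq_sym; apply: contra_neq ws0.
  by rewrite /weight -/(weight_step s0) => ->; rewrite mulr0.
have [e e0 he] := weight_step_left_constant s0.
exists (s0 - e), s0; split; first by lra.
by move=> s hs; rewrite /weight -/(weight_step s) he// mulr_gt0 ?expR_gt0.
Qed.

(** Roots are split off one by one, by induction on the degree. Finiteness is what makes the root
    set Lebesgue null. *)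
Lemma poly_roots_seq (q : {poly R}) : q != 0 ->
  exists rs : seq R, forall z, root q z -> z \in rs.
Proof.
elim: {q}(size q) {-2}q (leqnn (size q)) => [|n IH] q sq q0.
  by move: sq; rewrite leqn0 size_poly_eq0 (negbTE q0).
have [[r qr]|nr] := pselect (exists r, root q r); last first.
  by exists [::] => z qz; case: nr; exists z.
have /factor_theorem[p qE] := qr.
have p0 : p != 0 by apply: contra_neq q0 => p0; rewrite qE p0 mul0r.
have [|rs hrs] := IH p _ p0.
  by move: sq; rewrite qE size_Mmonic ?monicXsubC// size_XsubC; lia.
exists (r :: rs) => z; rewrite qE rootM root_XsubC inE orbC => /orP[->//|/hrs ->].
by rewrite orbT.
Qed.

(** If the integral of the nonnegative function q^2 w were 0, this function would vanish almost
    everywhere; on an interval where w > 0 it vanishes only at the roots of q, so that interval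
    would be null. *)
Lemma wfun_square_gt0 q : q != 0 -> 0 < wfun m c omega x (q * q).
Proof.
move=> q0.
have f0 s : 0 <= (q * q).[s] * weight m c omega x s.
  by rewrite mulr_ge0 ?weight_ge0// hornerM -expr2 sqr_ge0.
rewrite lt_neqAle Rintegral_ge0// andbT eq_sym; apply/eqP => int0.
have fi := integrable_poly_weight m c omega x (q * q).
have eint0 : (\int[mu]_s ((q * q).[s] * weight m c omega x s)%:E = 0)%E.
  rewrite -(fineK (integrable_fin_num measurableT fi)) /=.
  by rewrite -[fine _]/(wfun m c omega x (q * q)) int0.
have [a [b [ab wgt0]]] := weight_gt0_interval.
have := @ae_eq_integral_abs _ _ _ mu setT measurableT _ (measurable_int _ fi).
case=> + _; case.
  by rewrite -eint0; apply: eq_integral => s _; rewrite /= ger0_norm.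
move=> N [mN N0 hN].
have [rs hrs] := poly_roots_seq q0.
have sub : `]a, b]%classic `<=` N `|` [set` rs].
  move=> s /=; rewrite in_itv/= => hs.
  have [qs|qs] := boolP (root q s); first by right; exact: hrs.
  left; apply: hN => /= /(_ I) []; apply/eqP/mulf_neq0.
    by rewrite hornerM mulf_neq0.
  by rewrite gt_eqF ?wgt0.
have crs : countable [set` rs].
  by apply: finite_set_countable; exact: finite_seq.
have rs0 : mu [set` rs] = 0%E.
  exact: countable_lebesgue_measure0.
have mrs : measurable [set` rs].
  exact: countable_measurable.
have : mu `]a, b]%classic = 0%E.
  apply/eqP; rewrite -measure_le0 -(null_set_setU mN mrs N0 rs0).
  apply: le_measure => //; rewrite inE; first exact: measurable_itv.
  exact: measurableU.
rewrite lebesgue_measure_itv/= lte_fin ab -EFinB => /eqP.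
by rewrite eqe subr_eq0 gt_eqF.
Qed.

End Positivity.

(** * Orthogonal polynomials of a positive functional *)

Section OrthogonalPolynomials.
Variables (R : realFieldType) (ell : {poly R} -> R).

(* [(op_pair n).1] is P_{n-1}, with P_{-1} = 0; the division by ell 0 = 0
   occurring at n = 0 is harmless because it multiplies P_{-1}. *)
Fixpoint op_pair (n : nat) : {poly R} * {poly R} :=
  if n is n'.+1 then
    let: (p', p) := op_pair n' in
    (p, ('X - (ell ('X * (p * p)) / ell (p * p))%:P) * p -
        (ell (p * p) / ell (p' * p')) *: p')
  else (0, 1).

Definition op n := (op_pair n).2.
Definition opm n := (op_pair n).1.
Definition op_norm n := ell (op n * op n).
Definition op_a n := ell ('X * (op n * op n)) / op_norm n.
Definition op_b n := op_norm n / ell (opm n * opm n).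

Lemma opS n : op n.+1 = ('X - (op_a n)%:P) * op n - op_b n *: opm n.
Proof. by rewrite /op_b /op_a /op_norm /op /opm /=; case: (op_pair n). Qed.

Lemma opmS n : opm n.+1 = op n.
Proof. by rewrite /op /opm /=; case: (op_pair n). Qed.

Lemma op_bS n : op_b n.+1 = op_norm n.+1 / op_norm n.
Proof. by rewrite /op_b opmS. Qed.

Lemma op_monic_size n : [/\ op n \is monic, size (op n) = n.+1 & (size (opm n) <= n)%N].
Proof.
elim: n => [|n [mn sn sm]]; first by rewrite /op /opm /= monic1 size_poly1 size_poly0.
have sX : size (('X - (op_a n)%:P) * op n) = n.+2.
  by rewrite size_Mmonic ?polyXsubC_eq0// size_XsubC sn.
have sb : (size (- (op_b n *: opm n))%R < size (('X - (op_a n)%:P) * op n)%R)%N.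
  by rewrite size_polyN sX ltnS (leq_trans (size_scale_leq _ _))// (leq_trans sm).
rewrite opmS sn opS; split=> //; last by rewrite size_polyDl.
by rewrite monicE lead_coefDl// -monicE monicMl// monicXsubC.
Qed.

Lemma op_monic n : op n \is monic. Proof. by case: (op_monic_size n). Qed.
Lemma size_op n : size (op n) = n.+1. Proof. by case: (op_monic_size n). Qed.
Lemma size_opm n : (size (opm n) <= n)%N. Proof. by case: (op_monic_size n). Qed.

Lemma op_coef_lead n : (op n)`_n = 1.
Proof. by have /monicP := op_monic n; rewrite lead_coefE size_op. Qed.

Lemma op_neq0 n : op n != 0. Proof. exact: monic_neq0 (op_monic n). Qed.

End OrthogonalPolynomials.

Lemma size_sub_lead (R : realFieldType) (p q : {poly R}) (n : nat) :
  (size p <= n.+1)%N -> (size q <= n.+1)%N -> p`_n = q`_n ->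
  (size (p - q)%R <= n)%N.
Proof.
move=> sp sq pq; apply/leq_sizeP => j; rewrite leq_eqVlt => /orP[/eqP <-|nj].
  by rewrite coefB pq subrr.
by rewrite coefB !nth_default ?subrr// ?(leq_trans sp) ?(leq_trans sq).
Qed.

(** * Orthogonality, uniqueness and the Hankel determinant *)

Section Orthogonality.
Variables (R : realFieldType) (ell : {scalar {poly R}}).
Hypothesis ell_pos : forall q : {poly R}, q != 0 -> 0 < ell (q * q).
Implicit Types (p q : {poly R}) (n : nat).
Notation P := (op ell).
Notation h := (op_norm ell).
Notation a := (op_a ell).
Notation b := (op_b ell).

Let ellZ (r : R) q : ell (r *: q) = r * ell q. Proof. exact: linearZ. Qed.

Let ellB p q : ell (p - q) = ell p - ell q. Proof. exact: linearB. Qed.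

Lemma op_norm_gt0 n : 0 < h n. Proof. exact/ell_pos/op_neq0. Qed.

Lemma op_norm_neq0 n : h n != 0. Proof. by rewrite gt_eqF ?op_norm_gt0. Qed.

Lemma ell_eq0 n p : (size p <= n)%N ->
  (forall q, (size q <= n)%N -> ell (p * q) = 0) -> p = 0.
Proof.
move=> sp hp; apply/eqP; apply: contraT => /ell_pos.
by rewrite hp// ltxx.
Qed.

(** Subtracting q_n P_n from q lowers the degree. Orthogonality at n is a hypothesis because the
    lemma is used inside the induction that establishes it. *)
Let ell_lead n q : (forall r : {poly R}, (size r <= n)%N -> ell (P n * r) = 0) ->
  (size q <= n.+1)%N -> ell (P n * q) = q`_n * h n.
Proof.
move=> on sq; have -> : q = (q - q`_n *: P n) + q`_n *: P n by rewrite subrK.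
rewrite mulrDr linearD /= on ?add0r; last first.
  apply: size_sub_lead => //; first by rewrite (leq_trans (size_scale_leq _ _)) ?size_op.
  by rewrite coefZ op_coef_lead mulr1.
by rewrite -scalerAr linearZ /= subrK.
Qed.

(** Two consecutive indices are carried along because the three-term recurrence reaches back two
    steps. *)
Lemma op_ortho_pair n :
  (forall q, (size q <= n)%N -> ell (P n * q) = 0) /\
  (forall q, (size q <= n.+1)%N -> ell (P n.+1 * q) = 0).
Proof.
(* The choice of a_k kills the pairing of P_{k+1} with P_k. On a remainder r of lower degree, X P_k
   gives r_{k-1} h_k, which the b_k term cancels. The factor [(0 < k)%N%:R] covers k = 0, where
   P_{-1} = 0. *)
have step k : (forall q, (size q <= k)%N -> ell (P k * q) = 0) ->
    (forall q, (size q <= k)%N -> ell (opm ell k * q) = q`_k.-1 * ell (opm ell k * opm ell k)) ->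
    b k * ell (opm ell k * opm ell k) = (0 < k)%N%:R * h k ->
    ell (P k * opm ell k) = 0 ->
    (forall q, (size q <= k.+1)%N -> ell (P k.+1 * q) = 0).
  move=> ok om bk okm q sq.
  have -> : q = (q - q`_k *: P k) + q`_k *: P k by rewrite subrK.
  set r := q - _.
  have sr : (size r <= k)%N.
    apply: size_sub_lead => //; first by rewrite (leq_trans (size_scale_leq _ _)) ?size_op.
    by rewrite coefZ op_coef_lead mulr1.
  rewrite mulrDr linearD /= -scalerAr linearZ /=.
  have -> : ell (P k.+1 * P k) = 0.
    rewrite opS !mulrBl -scalerAl -!mulrA mul_polyC !ellB !ellZ.
    rewrite [opm _ _ * _]mulrC okm mulr0 subr0.
    by rewrite /op_a divfK ?subrr ?op_norm_neq0.
  rewrite mulr0 addr0 opS !mulrBl -scalerAl -!mulrA mul_polyC !ellB !ellZ.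
  rewrite om// (ok r)// mulr0 subr0 mulrCA.
  rewrite ell_lead//; last by rewrite (leq_trans (size_polyMleq _ _)) ?size_polyX.
  rewrite coefXM; case: k {ok om okm} bk sq @r sr => [|k] bk sq r sr /=.
    rewrite mul0r sub0r.
    by rewrite nth_default ?mul0r ?mulr0 ?oppr0.
  by rewrite mulrCA bk mul1r subrr.
elim: n => [|n [IH0 IH1]].
  split=> [q|]; first by rewrite leqn0 size_poly_eq0 => /eqP ->; rewrite mulr0 linear0.
  apply: step => [q||/=|].
  - by rewrite leqn0 size_poly_eq0 => /eqP ->; rewrite mulr0 linear0.
  - by move=> q _; rewrite /opm /= !mul0r linear0 mulr0.
  - by rewrite /opm /= mul0r linear0 mulr0 mul0r.
  - by rewrite /opm /= mulr0 linear0.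
split=> //; apply: step => //=.
- by move=> q sq; rewrite opmS ell_lead.
- by rewrite opmS op_bS divfK ?op_norm_neq0// mul1r.
- by rewrite opmS IH1 ?size_op.
Qed.

Lemma op_ortho n q : (size q <= n)%N -> ell (P n * q) = 0.
Proof. by case: (op_ortho_pair n) => + _; exact. Qed.

Lemma op_ell_lead n q : (size q <= n.+1)%N -> ell (P n * q) = q`_n * h n.
Proof. by apply: ell_lead; exact: op_ortho. Qed.

Lemma op_X n : 'X * P n = P n.+1 + (a n)%:P * P n + b n *: opm ell n.
Proof. by rewrite opS; ring. Qed.

(** The difference of two candidates has degree below n and is orthogonal to every polynomial of
    degree below n, itself included. *)
Lemma op_unique n p : p \is monic -> size p = n.+1 ->
  (forall j, (j < n)%N -> ell (p * 'X^j) = 0) -> p = P n.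
Proof.
move=> mp sp op; apply/eqP; rewrite -subr_eq0; apply/eqP.
apply: (@ell_eq0 n).
  apply: size_sub_lead; rewrite ?sp ?size_op// op_coef_lead.
  by have /monicP := mp; rewrite lead_coefE sp.
move=> q sq; rewrite mulrBl linearB /= op_ortho// subr0.
rewrite -[q]coefK poly_def mulr_sumr linear_sum big1// => i _.
by rewrite -scalerAr linearZ /= op ?mulr0// (leq_trans _ sq).
Qed.

(** With C the unit lower triangular matrix of coefficients of the P_i, the product C H C^T is their
    Gram matrix, which is diagonal. *)
Lemma hankel_det n :
  \det (\matrix_(i < n, j < n) ell 'X^(i + j)) = \prod_(i < n) h i.
Proof.
pose C := \matrix_(i < n, j < n) (P i)`_j.
set H := \matrix_(i, j) _.
have expand (i : 'I_n) : P i = \sum_(k < n) C i k *: 'X^k.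
  apply/polyP => j; under eq_bigr do rewrite mxE.
  rewrite -(poly_def n (fun k => (P i)`_k)) coef_poly; case: ltnP => // nj.
  by rewrite nth_default// size_op; have := ltn_ord i; lia.
have CHC : C *m H *m C^T = diag_mx (\row_i h i).
  apply/matrixP => i j; rewrite !mxE.
  have -> : \sum_k (C *m H) i k * C^T k j = ell (P i * P j).
    rewrite (expand j) mulr_sumr linear_sum; apply: eq_bigr => k _.
    rewrite [(C *m H) i k]mxE [C^T k j]mxE (expand i) -scalerAr [RHS]linearZ /=.
    rewrite mulrC mulr_suml linear_sum /=; congr (_ * _).
    by apply: eq_bigr => l _; rewrite [H l k]mxE -scalerAl linearZ /= exprD.
  have [->|ij] := eqVneq i j; first by rewrite mulr1n.
  rewrite mulr0n; case: (ltngtP i j) => lij.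
  - by rewrite mulrC op_ortho// size_op.
  - by rewrite op_ortho// size_op.
  - by move/val_inj: lij ij => ->; rewrite eqxx.
have detC : \det C = 1.
  rewrite det_trig; last first.
    apply/is_trig_mxP => i j ij; rewrite mxE nth_default// size_op//.
  by rewrite big1// => i _; rewrite mxE op_coef_lead.
have := congr1 determinant CHC.
rewrite !det_mulmx det_tr detC mul1r mulr1 => ->.
by rewrite det_diag; apply: eq_bigr => i _; rewrite mxE.
Qed.

End Orthogonality.

(** * Evolution of the orthogonal polynomials in x *)

Section PolynomialCurves.
Variable R : realType.
Implicit Types (P Q : R -> {poly R}) (x : R) (p q : {poly R}).

(** Differentiation is coefficientwise; the uniform degree bound turns every linear functional of
    the curve into a sum of fixed finite length. *)
Definition is_pderive P x (dP : {poly R}) : Prop :=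
  (exists N : nat, forall y, (size (P y) <= N)%N) /\
  forall i, is_derive x 1 (fun y => (P y)`_i) dP`_i.

Lemma is_pderive_cst p x : is_pderive (fun=> p) x 0.
Proof.
by split=> [|i]; [exists (size p)|rewrite coef0; exact: is_derive_cst].
Qed.

Lemma is_pderive_sub P Q x dP dQ : is_pderive P x dP -> is_pderive Q x dQ ->
  is_pderive (fun y => P y - Q y) x (dP - dQ).
Proof.
move=> [[M hM] hP] [[N hN] hQ]; split=> [|i].
  exists (maxn M N) => y; rewrite (leq_trans (size_polyD _ _))// size_polyN.
  by rewrite geq_max (leq_trans (hM y)) ?leq_maxl// (leq_trans (hN y)) ?leq_maxr.
by under eq_fun do rewrite coefB; rewrite coefB; exact: is_derive_sub.
Qed.

Lemma is_pderive_mul P Q x dP dQ : is_pderive P x dP -> is_pderive Q x dQ ->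
  is_pderive (fun y => P y * Q y) x (dP * Q x + P x * dQ).
Proof.
move=> [[M hM] hP] [[N hN] hQ]; split=> [|i].
  exists (M + N)%N => y; rewrite (leq_trans (size_polyMleq _ _))//.
  by rewrite (leq_trans (leq_pred _))// leq_add.
under eq_fun do rewrite coefM; rewrite coefD !coefM -big_split /=.
by apply: is_derive_bigsum => j _; exact: is_derive_mul.
Qed.

Lemma is_pderive_polyC (r : R -> R) x dr : is_derive x 1 r dr ->
  is_pderive (fun y => (r y)%:P) x dr%:P.
Proof.
move=> hr; split=> [|i]; first by exists 1%N => y; exact: size_polyC_leq1.
under eq_fun do rewrite coefC; rewrite coefC; case: eqP => // _.
exact: is_derive_cst.
Qed.

Lemma poly_sum_coef N p : (size p <= N)%N -> p = \sum_(i < N) p`_i *: 'X^i.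
Proof.
move=> sp; rewrite -(poly_def N (fun i => p`_i)); apply/polyP => j.
by rewrite coef_poly; case: ltnP => // Nj; rewrite nth_default// (leq_trans sp).
Qed.

Lemma size_pderive P x dP (N : nat) : is_pderive P x dP ->
  (forall y, (size (P y) <= N)%N) -> (size dP <= N)%N.
Proof.
move=> [_ hP] hN; apply/leq_sizeP => j Nj.
apply: (is_derive_unique (hP j)).
have -> : (fun y => (P y)`_j) = cst 0.
  by apply/funext => y; rewrite nth_default// (leq_trans (hN y)).
exact: is_derive_cst.
Qed.

(** A product rule when both the functional and its argument move: expand on monomials and
    differentiate each product. *)
Lemma is_derive_pairing (F : R -> {poly R} -> R) (F' : {poly R} -> R) P x dP :
  (forall y, linear_for *%R (F y)) ->
  (forall q, is_derive x 1 (fun y => F y q) (F' q)) ->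
  is_pderive P x dP ->
  is_derive x 1 (fun y => F y (P y)) (F x dP + F' (P x)).
Proof.
move=> linF dF PdP; have [[N hN] hP] := PdP.
have Fsum y p : (size p <= N)%N -> F y p = \sum_(i < N) p`_i * F y 'X^i.
  pose G : {scalar {poly R}} := HB.pack (F y)
    (GRing.isLinear.Build R {poly R} R *%R (F y) (linF y)).
  move=> /poly_sum_coef {1}->; rewrite -[LHS]/(G _) linear_sum.
  by apply: eq_bigr => i _; rewrite linearZ.
(* Linearity of F' is not assumed; this expansion follows from uniqueness of derivatives. *)
have -> : F' (P x) = \sum_(i < N) (P x)`_i * F' 'X^i.
  apply: (is_derive_unique (dF _)); under eq_fun do rewrite Fsum ?hN//.
  by apply: is_derive_bigsum => i _; exact: is_derive_mulr.
rewrite (Fsum _ _ (size_pderive PdP hN)) -big_split /=.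
under eq_fun do rewrite Fsum ?hN//.
by apply: is_derive_bigsum => i _; exact: is_derive_mul.
Qed.

Lemma is_derive_horner_curve P x dP (r : R) : is_pderive P x dP ->
  is_derive x 1 (fun y => (P y).[r + y]) (dP + (P x)^`()).[r + x].
Proof.
move=> hP; rewrite hornerD.
apply: (@is_derive_pairing (fun y p => p.[r + y]) (fun p => p^`().[r + x])) => //.
  by move=> y a p q; rewrite hornerD hornerZ.
by move=> q; exact: is_derive_horner_shift.
Qed.

End PolynomialCurves.

(** * Derivatives in x of P_n, h_n and the sum of the a_j *)

Section Deformation.
Variables (R : realType) (m : nat) (c omega : nat -> R).
Hypothesis c_incr : forall k : nat, (1 <= k)%N -> (k < m)%N -> c k < c k.+1.
Hypothesis partial_sum_ge0 :
  forall l : nat, (l <= m)%N -> 0 <= \sum_(0 <= k < l.+1) omega k.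
Hypothesis weight_neq0 :
  forall x : R, ~ (forall s : R, weight m c omega x s = 0).
Implicit Types (n : nat) (x : R).

Notation L x := (wfun m c omega x).
Notation P n x := (op (L x) n).
Notation Pm n x := (opm (L x) n).
Notation h n x := (op_norm (L x) n).
Notation a n x := (op_a (L x) n).
Notation b n x := (op_b (L x) n).

Let Lpos x q : q != 0 -> 0 < L x (q * q).
Proof. exact: wfun_square_gt0. Qed.

Lemma is_derive_wfun_curve (Q : R -> {poly R}) x dQ : is_pderive Q x dQ ->
  is_derive x 1 (fun y => L y (Q y)) (L x (dQ + gauss_deriv (Q x))).
Proof.
move=> hQ; rewrite linearD /=.
apply: (@is_derive_pairing _ (fun y p => L y p) (fun p => L x (gauss_deriv p))) => //.
  by move=> y; exact: wfun_is_linear.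
by move=> q; exact: is_derive_wfun.
Qed.

(** Existence only: the recurrence coefficients are quotients of differentiable functions with
    nonzero denominators. The value is identified next. *)
Lemma op_pderivable n : (forall x, exists d, is_pderive (fun y => P n y) x d) /\
  (forall x, exists d, is_pderive (fun y => Pm n y) x d).
Proof.
elim: n => [|n [IP IPm]].
  by split=> x; exists 0; exact: is_pderive_cst.
split=> x; last first.
  by have [d hd] := IP x; exists d; under eq_fun do rewrite opmS.
have [d hd] := IP x; have [dm hdm] := IPm x.
have hPP := is_pderive_mul hd hd.
have hh := is_derive_wfun_curve hPP.
have hX := is_derive_wfun_curve (is_pderive_mul (is_pderive_cst 'X x) hPP).
have ha := is_derive_div (op_norm_neq0 (@Lpos x) n) hX hh.
have hXa := is_pderive_mul (is_pderive_sub (is_pderive_cst 'X x) (is_pderive_polyC ha)) hd.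
have [db hb] : exists db, is_derive x 1 (fun y => b n y) db.
  case: n {IP IPm hXa hX hPP ha} d hd hdm hh => [|n] d hd hdm hh.
    (* For n = 0 the denominator is L(0) = 0, and division by zero yields 0. *)
    exists 0; have -> : (fun y => b 0%N y) = cst 0.
      by apply/funext => y; rewrite /op_b /opm /= mul0r linear0 invr0 mulr0.
    exact: is_derive_cst.
  have nz : L x (Pm n.+1 x * Pm n.+1 x) != 0.
    by rewrite opmS; exact: (op_norm_neq0 (@Lpos x)).
  have hmm := is_derive_wfun_curve (is_pderive_mul hdm hdm).
  by eexists; exact: (is_derive_div nz hh hmm).
have hbm := is_pderive_mul (is_pderive_polyC hb) hdm.
have := is_pderive_sub hXa hbm; set D := (X in is_pderive _ _ X) => hD.
exists D; under eq_fun do rewrite opS -mul_polyC.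
exact: hD.
Qed.

(* Differentiating [L y (P n y * q) = 0] for a fixed [q] of degree less than
   [n] determines all the coefficients of the derivative of [P n]. *)
Lemma is_pderive_op n x :
  is_pderive (fun y => P n y) x ((2 * b n x) *: Pm n x - (P n x)^`()).
Proof.
have [d hd] := (op_pderivable n).1 x.
suff /eqP : d + (P n x)^`() - (2 * b n x) *: Pm n x = 0.
  by rewrite subr_eq0 => /eqP <-; rewrite addrK.
have sd : (size d <= n)%N.
  have hn y : (size (P n y) <= n.+1)%N by rewrite size_op.
  have sd := size_pderive hd hn.
  rewrite -[d]subr0; apply: size_sub_lead => //; first by rewrite size_poly0.
  rewrite coef0; apply: (is_derive_unique (hd.2 n)).
  under eq_fun do rewrite op_coef_lead; exact: is_derive_cst.
have sP : (size (P n x)^`() <= n)%N.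
  by have := lt_size_deriv (op_neq0 (L x) n); rewrite size_op.
have sB : (size ((2 * b n x) *: Pm n x) <= n)%N.
  by rewrite (leq_trans (size_scale_leq _ _))// size_opm.
apply: (@ell_eq0 _ (L x) (@Lpos x) n).
  rewrite (leq_trans (size_polyD _ _))// geq_max size_polyN sB andbT.
  by rewrite (leq_trans (size_polyD _ _))// geq_max sd.
move=> q sq.
have := is_derive_wfun_curve (is_pderive_mul hd (is_pderive_cst q x)).
have -> : (fun y => L y (P n y * q)) = cst 0.
  by apply/funext => y; rewrite (op_ortho (@Lpos y)).
move=> /is_derive_unique/(_ (is_derive_cst _ _ _)).
rewrite mulr0 addr0 /gauss_deriv derivM.
(* Here P_n q' pairs to 0 and P_n (X q) to q_{n-1} h_n. Hence the nabla P_n term pairs with q to 2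
   q_{n-1} h_n, which is also 2 b_n L(P_{n-1} q). *)
have -> : d * q + ((P n x)^`() * q + P n x * q^`() - 2 *: ('X * (P n x * q))) =
  (d + (P n x)^`()) * q + P n x * q^`() - 2 *: (P n x * ('X * q)).
  by rewrite mulrCA; ring.
rewrite linearB linearD linearZ /= (op_ortho (@Lpos x))//; last first.
  have [->|q0] := eqVneq q 0; first by rewrite deriv0 size_poly0.
  by rewrite (leq_trans _ sq)// ltnW// lt_size_deriv.
rewrite (op_ell_lead (@Lpos x))//; last first.
  by rewrite (leq_trans (size_polyMleq _ _))// size_polyX.
rewrite addr0 => /eqP; rewrite subr_eq0 => /eqP e.
rewrite mulrBl linearB /= e -scalerAl linearZ /= coefXM.
case: n {hd sd sP sB e} sq => [|n] sq.
  by move: sq; rewrite leqn0 size_poly_eq0 => /eqP ->; rewrite /= mulr0 linear0 mul0r !mulr0 subr0.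
rewrite opmS (op_ell_lead (@Lpos x))// op_bS /=; field.
exact: (op_norm_neq0 (@Lpos x)).
Qed.

(** The contribution of nabla P_n = 2 b_n P_{n-1} is orthogonal to P_n, so only the - 2 X P_n^2 term
    survives. *)
Lemma is_derive_op_norm n x :
  is_derive x 1 (fun y => h n y) (- 2 * a n x * h n x).
Proof.
have hP := is_pderive_op n x; have hPP := is_pderive_mul hP hP.
apply: (is_derive_eq (is_derive_wfun_curve hPP)).
set d := _ - _; rewrite /gauss_deriv derivM.
have -> : d * P n x + P n x * d + ((P n x)^`() * P n x + P n x * (P n x)^`() -
    2 *: ('X * (P n x * P n x))) =
  2 *: (P n x * (d + (P n x)^`())) - 2 *: ('X * (P n x * P n x)).
  by rewrite !scaler_nat; ring.
rewrite /d subrK -scalerAr linearB !linearZ /= (op_ortho (@Lpos x)) ?size_opm//.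
rewrite /op_a /GRing.scale /=; field; exact: (op_norm_neq0 (@Lpos x)).
Qed.

Lemma op_coef_sublead n x : (P n.+1 x)`_n = - \sum_(j < n.+1) a j x.
Proof.
elim: n => [|n IH].
  rewrite big_ord1 opS /op /opm /= scaler0 subr0 mulr1 coefB coefX coefC /=.
  by rewrite sub0r.
rewrite big_ord_recr /= opprD -IH opS coefB coefZ mulrBl coefB coefXM coefCM /=.
rewrite op_coef_lead mulr1 [(Pm _ _)`__]nth_default ?mulr0 ?subr0//.
exact: size_opm.
Qed.

(** Minus this sum is the subleading coefficient of P_{n+1}, whose derivative is read off from
    [is_pderive_op]. *)
Lemma is_derive_sum_op_a n x : is_derive x 1
  (fun y => \sum_(j < n.+1) a j y) (n.+1%:R - 2 * b n.+1 x).
Proof.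
have [_ /(_ n) hP] := is_pderive_op n.+1 x.
have -> : (fun y => \sum_(j < n.+1) a j y) = (fun y => - (P n.+1 y)`_n).
  by apply/funext => y; rewrite op_coef_sublead opprK.
apply: (is_derive_eq (is_deriveN hP)).
rewrite coefB coefZ coef_deriv opmS !op_coef_lead; ring.
Qed.

End Deformation.

(** * Ladder relations at the jumps *)

Section LadderRelations.
Variables (R : realType) (m : nat) (c omega : nat -> R).
Hypothesis c_incr : forall k : nat, (1 <= k)%N -> (k < m)%N -> c k < c k.+1.
Hypothesis partial_sum_ge0 :
  forall l : nat, (l <= m)%N -> 0 <= \sum_(0 <= k < l.+1) omega k.
Hypothesis weight_neq0 :
  forall x : R, ~ (forall s : R, weight m c omega x s = 0).
Implicit Types (n k : nat) (x : R).

Notation L x := (wfun m c omega x).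
Notation P n x := (op (L x) n).
Notation Pm n x := (opm (L x) n).
Notation h n x := (op_norm (L x) n).
Notation a n x := (op_a (L x) n).
Notation b n x := (op_b (L x) n).
Notation sigma n x := (\sum_(j < n.+1) a j x).

Let Lpos x q : q != 0 -> 0 < L x (q * q).
Proof. exact: wfun_square_gt0. Qed.

Let hN0 n x : h n x != 0. Proof. exact: (op_norm_neq0 (@Lpos x)). Qed.

Definition jump k x : R := omega k * expR (- (c k + x) ^+ 2).

(* [jump2 n k] is R_{n,k}; [jump11 n k] is the companion quantity
   omega_k e^{-t_k^2} P_{n+1}(t_k) P_n(t_k) / h_n. *)
Definition jump2 n k x : R := jump k x * (P n x).[c k + x] ^+ 2 / h n x.
Definition jump11 n k x : R :=
  jump k x * (P n.+1 x).[c k + x] * (P n x).[c k + x] / h n x.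

Notation S n x := (\sum_(1 <= j < m.+1) jump2 n j x).

(** The recursively built polynomial meets the specification, and uniqueness identifies it with the
    one selected by [xget]. *)
Lemma OP_op n x : OP m c omega n x = P n x.
Proof.
have opP : is_monic_OP m c omega x n (P n x).
  split; first exact: op_monic.
  split; first exact: size_op.
  move=> j jn.
  have -> : (fun s => (P n x).[s] * s ^+ j * weight m c omega x s) =
      (fun s => (P n x * 'X^j).[s] * weight m c omega x s).
    by apply/funext => s; rewrite hornerM hornerXn.
  by rewrite -/(L x (P n x * 'X^j)) (op_ortho (@Lpos x))// size_polyXn.
rewrite /OP; case: xgetP => [p _ [mp [sp op]]|/(_ (P n x)) //].
apply: (op_unique (@Lpos x)) => // j jn; rewrite -(op j jn) /wfun.
by congr Defs.Rint; apply/funext => s; rewrite hornerM hornerXn.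
Qed.

Lemma hnorm_op n x : hnorm m c omega n x = h n x.
Proof.
rewrite /hnorm OP_op /op_norm /wfun; congr Defs.Rint.
by apply/funext => s; rewrite hornerM expr2.
Qed.

Lemma Rnk_jump2 n k : Rnk m c omega n k = jump2 n k.
Proof. by apply/funext => x; rewrite /Rnk OP_op hnorm_op. Qed.

Lemma hankelD_op n x : hankelD m c omega n x = \prod_(i < n) h i x.
Proof.
rewrite -hankel_det /hankelD; last exact: Lpos.
by congr determinant; apply/matrixP => i j; rewrite !mxE momentE.
Qed.

Lemma wfun_gauss_deriv q x : L x (gauss_deriv q) =
  - \sum_(1 <= k < m.+1) jump k x * q.[c k + x].
Proof.
rewrite wfun_by_parts; congr (- _); apply: eq_bigr => k _.
by rewrite /gauss_poly /jump; ring.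
Qed.

(** Integration by parts for P_n^2: the term 2 P_n P_n' pairs to 0. *)
Lemma sum_jump2 n x : S n x = 2 * a n x.
Proof.
have := wfun_gauss_deriv (P n x * P n x) x.
have -> : gauss_deriv (P n x * P n x) =
    2 *: (P n x * (P n x)^`()) - 2 *: ('X * (P n x * P n x)).
  by rewrite /gauss_deriv derivM !scaler_nat; ring.
rewrite linearB /= linearZ /= (op_ortho (@Lpos x)); last first.
  by have := lt_size_deriv (op_neq0 (L x) n); rewrite size_op.
rewrite linearZ /= mulr0 sub0r => /oppr_inj e.
rewrite /op_a mulrA e mulr_suml; apply: eq_bigr => k _.
by rewrite /jump2 hornerM expr2.
Qed.

Let size_derivP n x : (size (P n x)^`() <= n)%N.
Proof. by have := lt_size_deriv (op_neq0 (L x) n); rewrite size_op. Qed.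

Let sizeXM n (q : {poly R}) : (size q <= n)%N -> (size ('X * q)%R <= n.+1)%N.
Proof. by move=> sq; rewrite (leq_trans (size_polyMleq _ _))// size_polyX. Qed.

(** Integration by parts for P_{n+1} P_n: the leading coefficient n + 1 of P_{n+1}' and that of X
    P_n give the two terms. *)
Lemma sum_jump11 n x :
  \sum_(1 <= k < m.+1) jump11 n k x = 2 * b n.+1 x - n.+1%:R.
Proof.
have := wfun_gauss_deriv (P n.+1 x * P n x) x.
rewrite /gauss_deriv derivM [(P n.+1 x)^`() * _]mulrC linearB linearD linearZ /=.
rewrite mulrCA (op_ell_lead (@Lpos x) (size_derivP _ _)).
rewrite (op_ell_lead (@Lpos x) (n := n.+1) (q := 'X * P n x)) ?sizeXM ?size_op//.
rewrite (op_ortho (@Lpos x)) ?(leq_trans (size_derivP _ _))//.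
rewrite coef_deriv coefXM /= !op_coef_lead => e.
have -> : \sum_(1 <= k < m.+1) jump11 n k x =
    (\sum_(1 <= k < m.+1) jump k x * (P n.+1 x * P n x).[c k + x]) / h n x.
  by rewrite mulr_suml; apply: eq_bigr => k _; rewrite /jump11 hornerM mulrA.
have {e} -> : \sum_(1 <= k < m.+1) jump k x * (P n.+1 x * P n x).[c k + x] =
    2 * h n.+1 x - n.+1%:R * h n x.
  by apply: oppr_inj; rewrite -e; ring.
by rewrite op_bS mulrBl mulfK// mulrA.
Qed.

Lemma sum_point_jump11 n x :
  \sum_(1 <= k < m.+1) (c k + x) * jump11 n k x =
  2 * b n.+1 x * (a n.+1 x + a n x) - sigma n x.
Proof.
have := wfun_gauss_deriv ('X * (P n.+1 x * P n x)) x.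
set p := P n.+1 x; set q := P n x.
have ortho_pq : L x (p * q) = 0 by rewrite (op_ortho (@Lpos x))// size_op.
(* Subtracting (n+1) p cancels the top term of X p'. The remainder has degree at most n, and its X^n
   coefficient is n p_n - (n+1) p_n = - p_n = a_0 + ... + a_n. *)
have -> : gauss_deriv ('X * (p * q)) = p * q + q * ('X * p^`() - n.+1%:R *: p) +
    n.+1%:R *: (p * q) + p * ('X * q^`()) - 2 *: ('X * p * ('X * q)).
  by rewrite /gauss_deriv !derivM derivX !scaler_nat; ring.
have sl : (size ('X * p^`() - n.+1%:R *: p)%R <= n.+1)%N.
  apply: size_sub_lead; first by rewrite sizeXM// size_derivP.
    by rewrite (leq_trans (size_scale_leq _ _))// size_op.
  by rewrite coefXM coefZ /= coef_deriv op_coef_lead mulr1.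
have XX : L x ('X * p * ('X * q)) = (a n.+1 x + a n x) * h n.+1 x.
  rewrite [in 'X * q]op_X !mulrDr !linearD /= mul_polyC -!scalerAr !linearZ /=.
  have -> : L x ('X * p * p) = a n.+1 x * h n.+1 x.
    by rewrite /op_a divfK// mulrA.
  have -> : L x ('X * p * q) = h n.+1 x.
    rewrite -mulrA mulrCA (op_ell_lead (@Lpos x)) ?sizeXM ?size_op//.
    by rewrite coefXM /= op_coef_lead mul1r.
  have -> : L x ('X * p * Pm n x) = 0.
    by rewrite -mulrA mulrCA (op_ortho (@Lpos x)) ?sizeXM ?size_opm.
  ring.
have T2 : L x (q * ('X * p^`() - n.+1%:R *: p)) = sigma n x * h n x.
  rewrite (op_ell_lead (@Lpos x) sl) coefB coefZ coefXM op_coef_sublead.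
  have -> : (if n == 0%N then 0 else (p^`())`_n.-1) = - n%:R * sigma n x.
    case: n @p @q {ortho_pq sl XX} => [|n] p q /=; first by rewrite oppr0 mul0r.
    by rewrite coef_deriv op_coef_sublead mulNr mulr_natl mulNrn.
  by rewrite -natr1; ring.
have T3 : L x (p * ('X * q^`())) = 0.
  by rewrite (op_ortho (@Lpos x)) ?sizeXM ?size_derivP.
rewrite linearB !linearD /= [L x (_ *: (p * q))]linearZ [L x (2 *: _)]linearZ /=.
rewrite ortho_pq XX T2 T3 => e.
have -> : \sum_(1 <= k < m.+1) (c k + x) * jump11 n k x =
    (\sum_(1 <= k < m.+1) jump k x * ('X * (p * q)).[c k + x]) / h n x.
  rewrite mulr_suml; apply: eq_bigr => k _.
  by rewrite /jump11 !hornerM hornerX -/p -/q; ring.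
have {e} -> : \sum_(1 <= k < m.+1) jump k x * ('X * (p * q)).[c k + x] =
    2 * ((a n.+1 x + a n x) * h n.+1 x) - sigma n x * h n x.
  by apply: oppr_inj; rewrite -e -natr1; ring.
by rewrite op_bS; field; exact: hN0.
Qed.

Lemma jump11_square n k x :
  jump11 n k x ^+ 2 = b n.+1 x * jump2 n k x * jump2 n.+1 k x.
Proof. by rewrite /jump11 /jump2 op_bS; field; rewrite !hN0. Qed.

Lemma is_derive_jump k x : is_derive x 1 (jump k) (- 2 * (c k + x) * jump k x).
Proof.
apply: (is_derive_eq (is_derive_mulr _ (is_derive_gauss_shift (c k) x))).
by rewrite /jump; ring.
Qed.

(** The motion of the point t_k contributes P_n'(t_k), which cancels the - P_n' of
    [is_pderive_op]. *)
Lemma is_derive_op_horner n k x :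
  is_derive x 1 (fun y => (P n y).[c k + y]) (2 * b n x * (Pm n x).[c k + x]).
Proof.
have hP := is_pderive_op c_incr partial_sum_ge0 weight_neq0 n x.
apply: (is_derive_eq (is_derive_horner_curve (c k) hP)).
by rewrite subrK hornerZ.
Qed.

Lemma is_derive_jump2 n k x : is_derive x 1 (jump2 n.+1 k)
  (jump2 n.+1 k x * (2 * a n.+1 x - 2 * (c k + x)) + 4 * jump11 n k x).
Proof.
have hp := is_derive_op_horner n.+1 k x.
have hh := is_derive_op_norm c_incr partial_sum_ge0 weight_neq0 n.+1 x.
apply: (is_derive_eq (is_derive_div (hN0 n.+1 x)
  (is_derive_mul (is_derive_jump k x) (is_derive_mul hp hp)) hh)).
by rewrite opmS op_bS /jump2 /jump11; field; rewrite !hN0.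
Qed.

Lemma is_derive_jump11 n k x : is_derive x 1 (jump11 n k)
  (2 * b n.+1 x * (jump2 n k x - jump2 n.+1 k x)).
Proof.
have hp := is_derive_op_horner n.+1 k x.
have hq := is_derive_op_horner n k x.
have hh := is_derive_op_norm c_incr partial_sum_ge0 weight_neq0 n x.
(* The recurrence eliminates P_{n-1}, leaving only P_{n+1} and P_n, uniformly in n including n =
   0. *)
have e : 2 * b n x * (Pm n x).[c k + x] =
    2 * (((c k + x) - a n x) * (P n x).[c k + x] - (P n.+1 x).[c k + x]).
  by rewrite opS hornerD hornerN hornerM hornerXsubC hornerZ; ring.
rewrite e in hq.
apply: (is_derive_eq (is_derive_div (hN0 n x)
  (is_derive_mul (is_derive_mul (is_derive_jump k x) hp) hq) hh)).
by rewrite opmS op_bS /jump2 /jump11; field; rewrite !hN0.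
Qed.
End LadderRelations.

(** * Toda and Painleve equations *)

Section OrientedIntegral.
Variable R : realType.
Implicit Types f F : R -> R.

Lemma eq_oint f g (u v : R) :
  (forall y, Num.min u v <= y <= Num.max u v -> f y = g y) ->
  oint u v f = oint u v g.
Proof.
rewrite /oint; case: (leP u v) => uv fg; last congr (- _).
all: by apply: eq_Rintegral => y; rewrite inE/= in_itv/=; exact: fg.
Qed.

Lemma oint_FTC f F (u v : R) : (forall x : R, is_derive x 1 F (f x)) -> continuous f ->
  oint u v f = F v - F u.
Proof.
move=> dF cf.
have cF : continuous F by move=> x; exact: is_derive_continuous (dF x).
have ftc (p q : R) : p < q ->
    (\int[lebesgue_measure]_(x in `[p, q]) f x = F q - F p)%R.
  move=> pq; rewrite /Rintegral (@continuous_FTC2 _ f F) ?EFinB//.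
  - exact: continuous_subspaceT.
  - split; first by move=> x _; exact: (@ex_derive _ _ _ _ _ _ _ (dF x)).
      apply: cvg_at_right_filter; exact: cF.
    apply: cvg_at_left_filter; exact: cF.
  - by move=> x _; exact: is_derive_derive1.
rewrite /oint; case: (ltgtP u v) => [/ftc//|/ftc ->|->]; first by rewrite opprB.
by rewrite set_itv1 Rintegral_set1 subrr.
Qed.

End OrientedIntegral.

(** * The Toda equation, the second-order system and the integral formula, at degree n + 1 *)

Section PainleveEquations.
Variables (R : realType) (m : nat) (c omega : nat -> R).
Hypothesis c_incr : forall k : nat, (1 <= k)%N -> (k < m)%N -> c k < c k.+1.
Hypothesis partial_sum_ge0 :
  forall l : nat, (l <= m)%N -> 0 <= \sum_(0 <= k < l.+1) omega k.
Hypothesis weight_neq0 :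
  forall x : R, ~ (forall s : R, weight m c omega x s = 0).
Implicit Types (n k : nat) (x y : R).

Notation L x := (wfun m c omega x).
Notation h n x := (op_norm (L x) n).
Notation a n x := (op_a (L x) n).
Notation b n x := (op_b (L x) n).
Notation sigma n x := (\sum_(j < n.+1) a j x).
Notation Rn := (jump2 m c omega).
Notation rn := (jump11 m c omega).
Notation S n x := (\sum_(1 <= j < m.+1) Rn n j x).
Notation Dhat := (hankelDhat m c omega).

Let h_gt0 n x : 0 < h n x.
Proof. by apply: op_norm_gt0 => q; exact: wfun_square_gt0. Qed.

Let h_neq0 n x : h n x != 0. Proof. by rewrite gt_eqF. Qed.

Let prod_h_gt0 n x : 0 < \prod_(i < n) h i x.
Proof. by apply: prodr_gt0 => i _; exact: h_gt0. Qed.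

Lemma hankelDhat_op n x : Dhat n x = expR (n%:R * x ^+ 2) * \prod_(i < n) h i x.
Proof. by rewrite /hankelDhat hankelD_op. Qed.

Lemma hankelDhat_gt0 n x : 0 < Dhat n x.
Proof. by rewrite hankelDhat_op mulr_gt0 ?expR_gt0 ?prod_h_gt0. Qed.

Lemma ln_hankelDhat n x :
  ln (Dhat n x) = n%:R * x ^+ 2 + \sum_(i < n) ln (h i x).
Proof.
rewrite hankelDhat_op lnM ?posrE ?expR_gt0 ?prod_h_gt0// expRK; congr (_ + _).
elim: n => [|n IH]; first by rewrite !big_ord0 ln1.
by rewrite !big_ord_recr /= lnM ?posrE ?h_gt0 ?prod_h_gt0// IH.
Qed.

Lemma is_derive_ln_hankelDhat n x :
  is_derive x 1 (fun y => ln (Dhat n.+1 y)) (2 * n.+1%:R * x - 2 * sigma n x).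
Proof.
under eq_fun do rewrite ln_hankelDhat.
have dln i : is_derive x 1 (fun y => ln (h i y)) ((h i x)^-1 * (- 2 * a i x * h i x)).
  have dh := is_derive_op_norm c_incr partial_sum_ge0 weight_neq0 i x.
  exact: (is_derive1_comp (is_derive1_ln (h_gt0 i x)) dh).
have dx2 := is_derive_mulr n.+1%:R (is_derive_mul (is_derive_id x 1) (is_derive_id x 1)).
apply: (is_derive_eq (is_derive_add dx2 (is_derive_bigsum _ (fun (i : 'I_n.+1) _ => dln i)))).
congr (_ + _); first by ring.
by rewrite mulr_sumr -sumrN; apply: eq_bigr => i _; field; exact: h_neq0.
Qed.

(** The Gaussian prefactors cancel because (n+2) + n = 2 (n+1), and the products of norms reduce to
    h_{n+1} / h_n. *)
Lemma hankelDhat_ratio n x :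
  Dhat n.+2 x * Dhat n x / Dhat n.+1 x ^+ 2 = b n.+1 x.
Proof.
have e2 : expR (n.+2%:R * x ^+ 2) * expR (n%:R * x ^+ 2) =
    expR (n.+1%:R * x ^+ 2) ^+ 2.
  by rewrite [RHS]expr2 -!expRD; congr expR; rewrite -!natr1; ring.
have p0 : \prod_(i < n) h i x != 0 by rewrite gt_eqF.
have e0 : expR (n.+1%:R * x ^+ 2) != 0 by rewrite gt_eqF ?expR_gt0.
rewrite !hankelDhat_op !big_ord_recr /= mulrACA e2 op_bS.
by field; rewrite !h_neq0 p0 e0.
Qed.

(** The second derivative is 2 (n+1) - 2 ((n+1) - 2 b_{n+1}) = 4 b_{n+1}. *)
Lemma toda_equation n x :
  derivable (fun y => ln (Dhat n.+1 y)) x 1 /\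
  is_derive x 1 (derive1 (fun y => ln (Dhat n.+1 y)))
    (4 * (Dhat n.+2 x * Dhat n x) / Dhat n.+1 x ^+ 2).
Proof.
split; first exact: (@ex_derive _ _ _ _ _ _ _ (is_derive_ln_hankelDhat n x)).
rewrite -mulrA hankelDhat_ratio.
have -> : derive1 (fun y => ln (Dhat n.+1 y)) =
    (fun y => 2 * n.+1%:R * y - 2 * sigma n y).
  by apply/funext => y; exact/is_derive_derive1/is_derive_ln_hankelDhat.
have ds := is_derive_sum_op_a c_incr partial_sum_ge0 weight_neq0 n x.
apply: (is_derive_eq (is_derive_sub (is_derive_mulr (2 * n.+1%:R) (is_derive_id x 1))
  (is_derive_mulr 2 ds))).
ring.
Qed.

Lemma derive1_jump2 n k x : derive1 (Rn n.+1 k) x =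
  Rn n.+1 k x * (S n.+1 x - 2 * (c k + x)) + 4 * rn n k x.
Proof. by rewrite sum_jump2//; exact/is_derive_derive1/is_derive_jump2. Qed.

Lemma is_derive_sum_jump2 n x : is_derive x 1 (fun y => S n.+1 y)
  (S n.+1 x ^+ 2 - 2 * (\sum_(1 <= j < m.+1) (c j + x) * Rn n.+1 j x)
   + 4 * (2 * b n.+1 x - n.+1%:R)).
Proof.
apply: (is_derive_eq (is_derive_bigsum _ (fun j _ =>
  is_derive_jump2 c_incr partial_sum_ge0 weight_neq0 n j x))).
rewrite -(sum_jump11 c_incr partial_sum_ge0 weight_neq0) -sum_jump2//.
rewrite expr2 !mulr_sumr -sumrB -big_split /=.
by apply: eq_bigr => j _; ring.
Qed.

(** Differentiate the first-order relation for R_k once more: the b_{n+1} R_k terms coming from S'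
    and from r_k' cancel, and r_k is absorbed into R_k'. *)
Lemma is_derive_derive1_jump2 n k x : Rn n.+1 k x != 0 ->
  is_derive x 1 (derive1 (Rn n.+1 k))
    (1 / (2 * Rn n.+1 k x) * (derive1 (Rn n.+1 k) x) ^+ 2
     + Rn n.+1 k x *
       (3 / 2 * S n.+1 x ^+ 2
        - 2 * (\sum_(1 <= j < m.+1) (c k + c j + 2 * x) * Rn n.+1 j x)
        + 2 * ((c k + x) ^+ 2 - 2 * n.+1%:R - 1))).
Proof.
move=> R0; rewrite derive1_jump2.
have -> : derive1 (Rn n.+1 k) =
    (fun y => Rn n.+1 k y * (S n.+1 y - 2 * (c k + y)) + 4 * rn n k y).
  by apply/funext => y; exact: derive1_jump2.
have dR := is_derive_jump2 c_incr partial_sum_ge0 weight_neq0 n k x.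
have dr := is_derive_jump11 c_incr partial_sum_ge0 weight_neq0 n k x.
have dt := is_derive_add (is_derive_cst (c k) x 1) (is_derive_id x 1).
have dA := is_derive_sub (is_derive_sum_jump2 n x) (is_derive_mulr 2 dt).
apply: (is_derive_eq (is_derive_add (is_derive_mul dR dA) (is_derive_mulr 4 dr))).
have -> : \sum_(1 <= j < m.+1) (c k + c j + 2 * x) * Rn n.+1 j x =
    (c k + x) * S n.+1 x + \sum_(1 <= j < m.+1) (c j + x) * Rn n.+1 j x.
  by rewrite mulr_sumr -big_split /=; apply: eq_bigr => j _; ring.
rewrite -sum_jump2//.
have r2 := jump11_square c_incr partial_sum_ge0 weight_neq0 n k x.
(* Nonvanishing of R_{n+1,k} allows r_k^2 = b_{n+1} R_{n,k} R_{n+1,k} to be solved for b_{n+1}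
   R_{n,k}. *)
have -> : 2 * b n.+1 x * (Rn n k x - Rn n.+1 k x) =
    2 * (rn n k x ^+ 2 / Rn n.+1 k x) - 2 * b n.+1 x * Rn n.+1 k x.
  by rewrite r2; field.
move: (S n.+1 x) (\sum_(1 <= j < m.+1) _) (Rn n.+1 k x) R0 (rn n k x) => s t r r0 u.
by rewrite add0r /=; field.
Qed.

Lemma painleve_hamiltonian n y :
  (forall k, (1 <= k <= m)%N -> Rn n.+1 k y != 0) ->
  - (\sum_(1 <= k < m.+1) (derive1 (Rn n.+1 k) y) ^+ 2 / (2 * Rn n.+1 k y))
  + 1 / 2 * (S n.+1 y) ^+ 3
  + \sum_(1 <= k < m.+1) 2 * (c k + y) ^+ 2 * Rn n.+1 k y
  - (\sum_(1 <= k < m.+1) 2 * (c k + y) * Rn n.+1 k y + 4 * n.+1%:R) * S n.+1 y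
  = - 8 * sigma n y.
Proof.
(* The sum is given an opaque name so that it acts as a constant inside the other sums. *)
move=> R0; have [s sE] : {s | s = S n.+1 y} by exists (S n.+1 y).
rewrite -sE.
(* Expand the square of R_k' = R_k (s - 2 t_k) + 4 r_k. The term 8 r_k^2 / R_k becomes 8 b_{n+1}
   R_{n,k}, and the t_k^2 R_k sum cancels against the one in the integrand. *)
have -> : \sum_(1 <= k < m.+1) (derive1 (Rn n.+1 k) y) ^+ 2 / (2 * Rn n.+1 k y) =
  s ^+ 2 / 2 * s - s * (\sum_(1 <= k < m.+1) 2 * (c k + y) * Rn n.+1 k y)
  + \sum_(1 <= k < m.+1) 2 * (c k + y) ^+ 2 * Rn n.+1 k y
  + 4 * s * (\sum_(1 <= k < m.+1) rn n k y)
  - 8 * (\sum_(1 <= k < m.+1) (c k + y) * rn n k y)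
  + 8 * b n.+1 y * S n y.
  rewrite {2}sE !mulr_sumr -sumrB -!big_split -sumrB -big_split /=.
  apply: eq_big_nat => k km; rewrite derive1_jump2 -sE.
  have r2 := jump11_square c_incr partial_sum_ge0 weight_neq0 n k y.
  have bR : b n.+1 y * Rn n k y = rn n k y ^+ 2 / Rn n.+1 k y.
    by rewrite r2; field; exact: R0.
  by rewrite -[8 * _ * _]mulrA bR; field; exact: R0.
rewrite (sum_jump11 c_incr partial_sum_ge0 weight_neq0).
rewrite (sum_point_jump11 c_incr partial_sum_ge0 weight_neq0).
rewrite sE !(sum_jump2 c_incr partial_sum_ge0 weight_neq0).
by field.
Qed.

End PainleveEquations.

Unset Implicit Arguments.

Theorem theorem5p1 (R : realType) (m : nat) (c omega : nat -> R) (n : nat) :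
  (1 <= m)%N ->
  c 1%N = 0 ->
  (forall k : nat, (1 <= k)%N -> (k < m)%N -> c k < c k.+1) ->
  (forall l : nat, (l <= m)%N -> 0 <= \sum_(0 <= k < l.+1) omega k) ->
  (forall x : R, ~ (forall s : R, weight m c omega x s = 0)) ->
  (1 <= n)%N ->
  (* (i) *)
  (forall x : R,
     derivable (fun y => ln (hankelDhat m c omega n y)) x 1 /\
     is_derive x 1 (derive1 (fun y => ln (hankelDhat m c omega n y)))
       (4 * (hankelDhat m c omega n.+1 x * hankelDhat m c omega n.-1 x)
          / hankelDhat m c omega n x ^+ 2))
  /\
  (* (ii) *)
  (forall k : nat, (1 <= k <= m)%N ->
     (forall x : R, derivable (Rnk m c omega n k) x 1) /\
     forall x : R, Rnk m c omega n k x != 0 ->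
       is_derive x 1 (derive1 (Rnk m c omega n k))
         (1 / (2 * Rnk m c omega n k x) * (derive1 (Rnk m c omega n k) x) ^+ 2
          + Rnk m c omega n k x *
            (3 / 2 * (\sum_(1 <= j < m.+1) Rnk m c omega n j x) ^+ 2
             - 2 * \sum_(1 <= j < m.+1) (c k + c j + 2 * x) * Rnk m c omega n j x
             + 2 * ((c k + x) ^+ 2 - 2 * n%:R - 1))))
  /\
  (* (iii) *)
  (forall x : R,
     (forall k : nat, (1 <= k <= m)%N ->
        forall y : R, Num.min 0 x <= y <= Num.max 0 x -> Rnk m c omega n k y != 0) ->
     hankelDhat m c omega n x / hankelDhat m c omega n 0 =
     expR (n%:R * x ^+ 2) *
     expR (1 / 4 * oint 0 x (fun y =>
        - (\sum_(1 <= k < m.+1)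
              (derive1 (Rnk m c omega n k) y) ^+ 2 / (2 * Rnk m c omega n k y))
        + 1 / 2 * (\sum_(1 <= k < m.+1) Rnk m c omega n k y) ^+ 3
        + \sum_(1 <= k < m.+1) 2 * (c k + y) ^+ 2 * Rnk m c omega n k y
        - (\sum_(1 <= k < m.+1) 2 * (c k + y) * Rnk m c omega n k y + 4 * n%:R)
          * (\sum_(1 <= j < m.+1) Rnk m c omega n j y)))).
Proof.
move=> _ _ c_incr sum_ge0 weight_neq0; case: n => [//|n] _.
have RE : Rnk m c omega = jump2 m c omega.
  by apply/funext => i; apply/funext => k; exact: Rnk_jump2.
rewrite RE; split; first by move=> x; exact: toda_equation.
split=> [k _|x R0].
  split=> x; last exact: is_derive_derive1_jump2.
  exact: (@ex_derive _ _ _ _ _ _ _ (is_derive_jump2 c_incr sum_ge0 weight_neq0 n k x)).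
set D := hankelDhat m c omega n.+1.
have D0 y : 0 < D y by exact: hankelDhat_gt0.
(* The factor 4 undoes the 1/4 in front of the integral; removing n y^2 leaves - 8 times the sum of
   the a_j as derivative. *)
pose G (y : R) := 4 * (ln (D y) - n.+1%:R * (y * y)).
have dG (y : R) : is_derive y 1 G (- 8 * \sum_(j < n.+1) op_a (wfun m c omega y) j).
  have dlnD := is_derive_ln_hankelDhat c_incr sum_ge0 weight_neq0 n y.
  have dy2 := is_derive_mulr n.+1%:R (is_derive_mul (is_derive_id y 1) (is_derive_id y 1)).
  apply: (is_derive_eq (is_derive_mulr 4 (is_derive_sub dlnD dy2))).
  ring.
(* The R_{n,k} are known to be nonzero only between 0 and x, where the two integrands agree; the new
   one is continuous on the whole line. *)
rewrite (@eq_oint _ _ (fun y => - 8 * \sum_(j < n.+1) op_a (wfun m c omega y) j)).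
  rewrite (oint_FTC _ _ dG); last first.
    move=> y; apply: (@is_derive_continuous _ _ _ _ (is_derive_mulr (- 8)
      (is_derive_sum_op_a c_incr sum_ge0 weight_neq0 n y))).
  rewrite -expRD -[LHS]lnK ?posrE ?divr_gt0//; congr expR.
  by rewrite ln_div ?posrE// /G; field.
move=> y hy; apply: painleve_hamiltonian => // k km.
exact: R0.
Qed.
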